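(* Let $\beta\in\mathbb{R}$ and $\mathbf{z}\in K_{\exp}^*$ with $z_x<0$ such that $\mathcal{F}_\beta=\{\mathbf{z}\}^\perp\cap K_{\exp}$ is a one-dimensional face of $K_{\exp}$. Let $\eta>0$ and let $$\gamma_{\mathbf{z},\eta}:=\inf_{\mathbf{v}}\left\{\frac{\|\mathbf{w}-\mathbf{v}\|^{1/2}}{\|\mathbf{w}-\mathbf{u}\|}\;\Big|\;\mathbf{v}\in\partial K_{\exp}\cap B(\eta)\setminus\mathcal{F}_\beta,\ \mathbf{w}=P_{\{\mathbf{z}\}^\perp}\mathbf{v},\ \mathbf{u}=P_{\mathcal{F}_\beta}\mathbf{w},\ \mathbf{w}\ne\mathbf{u}\right\}.$$ Then $\gamma_{\mathbf{z},\eta}\in(0,\infty]$ and $$\mathrm{d}(\mathbf{q},\mathcal{F}_\beta)\le\max\{2\sqrt{\eta},2\gamma_{\mathbf{z},\eta}^{-1}\}\cdot\mathrm{d}(\mathbf{q},K_{\exp})^{1/2}\quad\text{whenever } \mathbf{q}\in\{\mathbf{z}\}^\perp\cap B(\eta).$$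
   Context: $\mathbb{R}^3$ carries the standard inner product and Euclidean norm; vectors are written $\mathbf{p}=(p_x,p_y,p_z)$. $K_{\exp}=\{(x,y,z):y>0,\ z\ge ye^{x/y}\}\cup\{(x,y,z):x\le0,\ z\ge0,\ y=0\}$ is the exponential cone, $K_{\exp}^*$ its dual cone, $\partial K_{\exp}$ its boundary, and $\mathcal{F}_\beta=\{(-\beta y+y,y,e^{1-\beta}y):y\ge0\}$ for $\beta\in\mathbb{R}$. $B(\eta)$ is the closed ball of radius $\eta$ centered at the origin, $\mathrm{d}(\cdot,C)$ the distance to $C$, $P_C$ the orthogonal projection onto the closed convex set $C$. Conventions: infimum over the empty set is $+\infty$ and $1/\infty=0$. *)

(* Defs.v *)
From HB Require Import structures.
From mathcomp Require Import all_boot all_order all_algebra.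
From mathcomp Require Import all_classical all_reals all_analysis.

Set Implicit Arguments.
Unset Strict Implicit.
Unset Printing Implicit Defensive.

Import Order.TTheory GRing.Theory Num.Theory.
Import numFieldNormedType.Exports.

Local Open Scope classical_set_scope.
Local Open Scope ring_scope.

(* The library norm `|v| on 'rV[R]_n is the sup norm, so the Euclidean
   structure is introduced separately. Both norms induce the same topology,
   hence closure and interior below are the usual ones. *)
Definition dot (R : realType) (n : nat) (u v : 'rV[R]_n) : R :=
  \sum_(i < n) u ord0 i * v ord0 i.

Definition enorm (R : realType) (n : nat) (v : 'rV[R]_n) : R :=
  Num.sqrt (dot v v).

Definition eball (R : realType) (n : nat) (r : R) : set 'rV[R]_n :=
  [set v | enorm v <= r].

Definition boundary (T : topologicalType) (A : set T) : set T :=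
  closure A `\` interior A.

Definition perp (R : realType) (n : nat) (z : 'rV[R]_n) : set 'rV[R]_n :=
  [set v | dot z v = 0].

Definition dual_cone (R : realType) (n : nat) (K : set 'rV[R]_n) :
    set 'rV[R]_n :=
  [set s | forall v, K v -> 0 <= dot s v].

(* inf set0 = 0 in the library: only meaningful for nonempty C. *)
Definition dist (R : realType) (n : nat) (v : 'rV[R]_n) (C : set 'rV[R]_n) : R :=
  inf [set enorm (v - c) | c in C].

(* The nearest point of C to v; it exists and is unique when C is nonempty,
   closed and convex (xget returns the default 0 if there is none). *)
Definition proj (R : realType) (n : nat) (C : set 'rV[R]_n) (v : 'rV[R]_n) :
    'rV[R]_n :=
  xget 0 [set p | C p /\ forall c, C c -> enorm (v - p) <= enorm (v - c)].

Definition convex_cone (R : realType) (n : nat) (C : set 'rV[R]_n) : Prop :=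
  [/\ C !=set0,
      convex_set (C : set (convex_lmodType 'rV[R]_n)) &
      forall (a : R) v, 0 <= a -> C v -> C (a *: v)].

Definition is_face (R : realType) (n : nat) (K F : set 'rV[R]_n) : Prop :=
  [/\ convex_cone F, F `<=` K &
      forall u v, K u -> K v -> F (u + v) -> F u /\ F v].

(* The linear span of C, i.e. the least subspace containing C, has dimension d;
   for a convex cone this is the dimension of its affine hull. *)
Definition cone_dim (R : realType) (n : nat) (C : set 'rV[R]_n) (d : nat) :
    Prop :=
  exists V : {vspace 'rV[R]_n},
    [/\ C `<=` [set` V],
        forall W : {vspace 'rV[R]_n}, C `<=` [set` W] -> (V <= W)%VS &
        \dim V = d].

Definition vec3 (R : realType) (x y z : R) : 'rV[R]_3 :=
  \row_(i < 3) [:: x; y; z]`_i.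

Definition xcoord (R : realType) (v : 'rV[R]_3) : R := v ord0 0.
Definition ycoord (R : realType) (v : 'rV[R]_3) : R := v ord0 1.
Definition zcoord (R : realType) (v : 'rV[R]_3) : R := v ord0 2.

Definition exp_cone (R : realType) : set 'rV[R]_3 :=
  [set v | 0 < ycoord v /\
           ycoord v * expR (xcoord v / ycoord v) <= zcoord v] `|`
  [set v | [/\ xcoord v <= 0, 0 <= zcoord v & ycoord v = 0]].

Definition exp_ray (R : realType) (beta : R) : set 'rV[R]_3 :=
  [set vec3 (- beta * y + y) y (expR (1 - beta) * y) | y in [set y | 0 <= y]].

Definition gamma (R : realType) (z : 'rV[R]_3) (beta eta : R) : \bar R :=
  ereal_inf [set r : \bar R | exists v w u : 'rV[R]_3,
    [/\ ((boundary (@exp_cone R) `&` eball eta) `\` exp_ray beta) v,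
        w = proj (perp z) v, u = proj (exp_ray beta) w, w <> u &
        r = (Num.sqrt (enorm (w - v)) / enorm (w - u))%:E]].

(* Main.v *)
Require Import Defs.
From HB Require Import structures.
From mathcomp Require Import all_boot all_order all_algebra.
From mathcomp Require Import all_classical all_reals all_analysis.
From mathcomp Require Import ring lra.

(* The normal z is a positive multiple of (-1, -beta, e^(beta-1)), so dot z v
   measures the gap in the tangent inequality of exp at 1 - beta. As exp is
   strictly convex, this gap is quadratic near the point of tangency and grows
   at least linearly away from it, so on K_exp with |v| <= eta the squared
   distance from v to the ray is at most C * dot z v. Since
   dot z v = dot z (v - w) <= |z| |v - w| for w the projection of v on z^perp,
   this gives gamma > 0.
   For the error bound take v := P_K q. Either v is on the ray, or v is a
   boundary point admissible for gamma, and then |q - w| and |w - v| are both at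
   most |q - v| because q is in z^perp. *)

Set Implicit Arguments.
Unset Strict Implicit.
Unset Printing Implicit Defensive.

Import Order.TTheory GRing.Theory Num.Theory.
Import numFieldNormedType.Exports.

Local Open Scope classical_set_scope.
Local Open Scope ring_scope.

(** * Euclidean inner product and norm *)

Lemma dotC (R : realType) (n : nat) (u v : 'rV[R]_n) : dot u v = dot v u.
Proof. by apply: eq_bigr => i _; rewrite mulrC. Qed.

Lemma dotDl (R : realType) (n : nat) (u v w : 'rV[R]_n) :
  dot (u + v) w = dot u w + dot v w.
Proof. by rewrite -big_split; apply: eq_bigr => i _; rewrite mxE mulrDl. Qed.

Lemma dotZl (R : realType) (n : nat) (a : R) (u v : 'rV[R]_n) :
  dot (a *: u) v = a * dot u v.
Proof. by rewrite mulr_sumr; apply: eq_bigr => i _; rewrite mxE mulrA. Qed.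

Lemma dotNl (R : realType) (n : nat) (u v : 'rV[R]_n) : dot (- u) v = - dot u v.
Proof. by rewrite -scaleN1r dotZl mulN1r. Qed.

Lemma dotDr (R : realType) (n : nat) (u v w : 'rV[R]_n) :
  dot w (u + v) = dot w u + dot w v.
Proof. by rewrite dotC dotDl !(dotC _ w). Qed.

Lemma dotZr (R : realType) (n : nat) (a : R) (u v : 'rV[R]_n) :
  dot u (a *: v) = a * dot u v.
Proof. by rewrite dotC dotZl dotC. Qed.

Lemma dotNr (R : realType) (n : nat) (u v : 'rV[R]_n) : dot u (- v) = - dot u v.
Proof. by rewrite dotC dotNl dotC. Qed.

Definition dotE := (dotDl, dotDr, dotNl, dotNr, dotZl, dotZr).

Lemma dot_ge0 (R : realType) (n : nat) (u : 'rV[R]_n) : 0 <= dot u u.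
Proof. by apply: sumr_ge0 => i _; rewrite -expr2 sqr_ge0. Qed.

Lemma enorm_ge0 (R : realType) (n : nat) (u : 'rV[R]_n) : 0 <= enorm u.
Proof. exact: sqrtr_ge0. Qed.

Lemma enorm_sqr (R : realType) (n : nat) (u : 'rV[R]_n) :
  enorm u ^+ 2 = dot u u.
Proof. by rewrite sqr_sqrtr ?dot_ge0. Qed.

Lemma ler_enorm (R : realType) (n : nat) (u v : 'rV[R]_n) :
  (enorm u <= enorm v) = (dot u u <= dot v v).
Proof. by rewrite ler_sqrt ?dot_ge0. Qed.

Lemma enorm0 (R : realType) (n : nat) : enorm (0 : 'rV[R]_n) = 0.
Proof. by rewrite /enorm -(scale0r 0) dotZl mul0r sqrtr0. Qed.

Lemma enormN (R : realType) (n : nat) (u : 'rV[R]_n) : enorm (- u) = enorm u.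
Proof. by rewrite /enorm dotNl dotNr opprK. Qed.

Lemma enormZ (R : realType) (n : nat) (a : R) (u : 'rV[R]_n) :
  enorm (a *: u) = `|a| * enorm u.
Proof.
by rewrite /enorm dotZl dotZr mulrA -expr2 sqrtrM ?sqr_ge0 // sqrtr_sqr.
Qed.

Lemma normr_coord_le_enorm (R : realType) (n : nat) (u : 'rV[R]_n) (i : 'I_n) :
  `|u ord0 i| <= enorm u.
Proof.
rewrite -sqrtr_sqr ler_sqrt ?dot_ge0 // /dot (bigD1 i) //= -expr2 lerDl.
by apply: sumr_ge0 => j _; rewrite -expr2 sqr_ge0.
Qed.

Lemma enorm_eq0 (R : realType) (n : nat) (u : 'rV[R]_n) : enorm u = 0 -> u = 0.
Proof.
move=> u0; apply/rowP => i; rewrite mxE; apply/eqP.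
by rewrite -normr_le0 -u0 normr_coord_le_enorm.
Qed.

(** Cauchy-Schwarz: the square norm of [|v|^2 u - (u.v) v] equals [|v|^2 (|u|^2 |v|^2 - (u.v)^2)]
    and is nonnegative. *)
Lemma dot_le_enorm (R : realType) (n : nat) (u v : 'rV[R]_n) :
  dot u v <= enorm u * enorm v.
Proof.
have [v0|v_neq0] := eqVneq (enorm v) 0.
  by rewrite v0 mulr0 (enorm_eq0 v0) -(scale0r 0) dotZr mul0r.
have v_gt0 : 0 < enorm v by rewrite lt_def v_neq0 enorm_ge0.
have := dot_ge0 (enorm v ^+ 2 *: u - dot u v *: v).
rewrite !dotE (dotC v u) -!enorm_sqr => h.
rewrite leNgt; apply/negP => lt_uv.
have := mulr_ge0 (enorm_ge0 u) (enorm_ge0 v) => uv0.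
suff : 0 < enorm v ^+ 2 * (dot u v ^+ 2 - (enorm u * enorm v) ^+ 2) by lra.
rewrite mulr_gt0 ?exprn_gt0 // subr_gt0 ltrXn2r //.
Qed.

Lemma enormD (R : realType) (n : nat) (u v : 'rV[R]_n) :
  enorm (u + v) <= enorm u + enorm v.
Proof.
rewrite -(@ler_pXn2r _ 2) ?nnegrE ?addr_ge0 ?enorm_ge0 //.
rewrite sqrrD !enorm_sqr !dotE (dotC v u).
have := dot_le_enorm u v; lra.
Qed.

Lemma dot_continuous (R : realType) (n : nat) (T : topologicalType)
    (f g : T -> 'rV[R]_n) : continuous f -> continuous g ->
  continuous (fun x => dot (f x) (g x)).
Proof.
move=> cf cg; rewrite /dot.
apply: (@continuous_big _ _ _ _ _ _ _ _ (fun i x => f x ord0 i * g x ord0 i)).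
  by move=> x; exact: add_continuous.
have coord_cont (h : T -> 'rV[R]_n) i :
    continuous h -> continuous (fun x => h x ord0 i).
  move=> ch x.
  apply: (@continuous_comp _ _ _ h (fun m : 'rV[R]_n => m ord0 i)).
    exact: ch.
  exact: coord_continuous.
by move=> i _ x; apply: continuousM; exact: coord_cont.
Qed.

Lemma enorm_sub_continuous (R : realType) (n : nat) (v : 'rV[R]_n) :
  continuous (fun c : 'rV[R]_n => enorm (v - c)).
Proof.
have sub_cont : continuous (fun c : 'rV[R]_n => v - c).
  by move=> c; apply: (@continuousB R _ _ (fun=> v) id c);
    [exact: cst_continuous | exact: cvg_id].
move=> c; apply: (@continuous_comp _ _ _ (fun c : 'rV[R]_n => dot (v - c) (v - c))
    Num.sqrt).
  exact: dot_continuous.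
exact: sqrt_continuous.
Qed.

(** * Nearest points of closed and convex sets *)

Lemma dist_le (R : realType) (n : nat) (C : set 'rV[R]_n) (v c : 'rV[R]_n) :
  C c -> dist v C <= enorm (v - c).
Proof.
move=> Cc; apply: ge_inf; last by exists c.
by exists 0 => _ [d _ <-]; exact: enorm_ge0.
Qed.

(** The predicate that [proj] passes to [xget], named so that any minimiser can be used without
    reference to the choice operator. *)
Definition nearest (R : realType) (n : nat) (C : set 'rV[R]_n)
    (v p : 'rV[R]_n) : Prop :=
  C p /\ forall c, C c -> enorm (v - p) <= enorm (v - c).

(** Convexity, written as a step from [u] towards [v], the form in which nearest points are
    perturbed. *)
Definition segment_closed (R : realType) (n : nat) (C : set 'rV[R]_n) : Prop :=
  forall u v t, C u -> C v -> 0 <= t <= 1 -> C (u + t *: (v - u)).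

Lemma dist_nearest (R : realType) (n : nat) (C : set 'rV[R]_n)
    (v p : 'rV[R]_n) : nearest C v p -> dist v C = enorm (v - p).
Proof.
move=> [Cp minp]; apply/eqP; rewrite eq_le dist_le //=.
apply: lb_le_inf; first by exists (enorm (v - p)), p.
by move=> _ [c Cc <-]; exact: minp.
Qed.

(** Only points of [C] at least as close as a chosen [c0] matter. They form a closed subset of a
    box, hence a compact set, on which the continuous distance to [v] attains its minimum. *)
Lemma nearest_exists (R : realType) (n : nat) (C : set 'rV[R]_n)
    (v : 'rV[R]_n) : closed C -> C !=set0 -> exists p, nearest C v p.
Proof.
move=> clC [c0 Cc0]; pose r := enorm (v - c0).
pose A := C `&` [set c | enorm (v - c) <= r].
have A0 : A !=set0 by exists c0; split => //=; exact: lexx.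
have clA : closed A.
  apply: closedI => //.
  apply: (@preimage_closed _ _ (fun c : 'rV[R]_n => enorm (v - c)) [set x | x <= r]).
    by move=> x _; exact: enorm_sub_continuous.
  exact: closed_le.
have cpA : compact A.
  apply: (subclosed_compact clA (@rV_compact R n
    (fun i => `[v ord0 i - r, v ord0 i + r]%classic) _)).
    by move=> i; exact: segment_compact.
  move=> c [_ /= vc] i; rewrite /= in_itv /=.
  have := le_trans (normr_coord_le_enorm (v - c) i) vc.
  rewrite !mxE ler_norml; lra.
have [p /set_mem [Cp pr] minp] := EVT_min_rV A0 cpA
  (continuous_subspaceT (@enorm_sub_continuous R n v)).
exists p; split => // c Cc; have [cr|/ltW rc] := leP (enorm (v - c)) r.
  by apply: minp; rewrite inE.
exact: le_trans rc.
Qed.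

Lemma proj_nearest (R : realType) (n : nat) (C : set 'rV[R]_n)
    (v : 'rV[R]_n) : closed C -> C !=set0 -> nearest C v (Defs.proj C v).
Proof.
move=> clC C0; apply: (@xgetPex _ 0 (nearest C v)).
exact: nearest_exists.
Qed.

(** Moving from [p] towards [c] cannot reduce the distance to [v], so [v - p] and [c - p] have
    nonpositive inner product; expanding [v - c] then gives the claim. *)
Lemma nearest_pythagoras (R : realType) (n : nat) (C : set 'rV[R]_n)
    (v p c : 'rV[R]_n) : segment_closed C -> nearest C v p -> C c ->
  enorm (v - p) ^+ 2 + enorm (p - c) ^+ 2 <= enorm (v - c) ^+ 2.
Proof.
move=> segC [Cp minp] Cc.
have min_seg t : 0 <= t <= 1 ->
    2 * t * dot (v - p) (c - p) <= t ^+ 2 * enorm (c - p) ^+ 2.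
  move=> t01; have := minp _ (segC _ _ _ Cp Cc t01).
  rewrite opprD addrA ler_enorm enorm_sqr.
  move: (v - p) (c - p) => a b; rewrite !dotE (dotC b a) => h; lra.
have vE : v - c = (v - p) - (c - p) by apply/rowP => i; rewrite !mxE; ring.
rewrite vE {vE} -(enormN (p - c)) opprB.
set D := dot (v - p) (c - p) in min_seg.
suff D0 : D <= 0.
  move: D0; rewrite /D !enorm_sqr; clear D min_seg; move: (v - p) (c - p) => a b.
  by rewrite !dotE (dotC b a) => h; lra.
(* If [D > 0], then [t = D / N] minimises [t^2 N - 2 t D], with value [- D^2 / N < 0]. The case
   [t = 1] ensures that this step is at most 1. *)
rewrite leNgt; apply/negP => D_gt0.
set N := enorm (c - p) ^+ 2 in min_seg.
have DN : 2 * D <= N by have := min_seg 1; rewrite ler01 lexx => /(_ isT); lra.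
have N_gt0 : 0 < N by lra.
have t01 : 0 <= D / N <= 1.
  by rewrite divr_ge0 ?ler_pdivrMr /= ?mul1r; lra.
have := min_seg _ t01.
have -> : 2 * (D / N) * D = 2 * (D ^+ 2 / N) by ring.
have -> : (D / N) ^+ 2 * N = D ^+ 2 / N by field; lra.
have : 0 < D ^+ 2 / N by rewrite divr_gt0 // exprn_gt0.
lra.
Qed.

Lemma nearest_le (R : realType) (n : nat) (C : set 'rV[R]_n)
    (v p c : 'rV[R]_n) : segment_closed C -> nearest C v p -> C c ->
  enorm (p - c) <= enorm (v - c).
Proof.
move=> segC vp Cc; have := nearest_pythagoras segC vp Cc.
rewrite ler_enorm -!enorm_sqr.
have := sqr_ge0 (enorm (v - p)); lra.
Qed.

(** Around an interior [p], a short step towards [v] would stay in [C] and come strictly closer to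
    [v]. *)
Lemma nearest_boundary (R : realType) (n : nat) (C : set 'rV[R]_n)
    (v p : 'rV[R]_n) : nearest C v p -> ~ C v -> boundary C p.
Proof.
move=> [Cp minp] nCv; split; first exact: subset_closure.
move=> intp.
have path_cont : (fun t : R => p + t *: (v - p)) t @[t --> 0] --> p.
  rewrite -[X in _ --> X](_ : p + 0 *: (v - p) = p); last first.
    by rewrite scale0r addr0.
  apply: cvgD; first exact: cvg_cst.
  by apply: cvgZr_tmp; exact: cvg_id.
have /path_cont/nbhs_ballP [e /= e_gt0 ballC] : nbhs p C by [].
pose t := Num.min (e / 2) 1.
have [t_gt0 t_le1 t_lt] : [/\ 0 < t, t <= 1 & t < e].
  rewrite /t; case: (leP (e / 2) 1) => h; split; lra.
have /minp : C (p + t *: (v - p)).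
  by apply: ballC; rewrite /ball /= sub0r normrN gtr0_norm.
have -> : v - (p + t *: (v - p)) = (1 - t) *: (v - p).
  by apply/rowP => i; rewrite !mxE; ring.
rewrite enormZ ger0_norm ?subr_ge0 //.
have /eqP vp0 : enorm (v - p) != 0.
  by apply/eqP => /enorm_eq0/subr0_eq vp; rewrite vp in nCv.
have vp_gt0 : 0 < enorm (v - p) by rewrite lt_def enorm_ge0 andbT; apply/eqP.
have := mulr_gt0 t_gt0 vp_gt0; lra.
Qed.

(** * Closedness and convexity of the exponential cone and of the hyperplane *)

(* These half-spaces lie above the tangents of exp at t: z >= y e^(x/y) is
   recovered at t = x/y, and x <= 0 when y = 0 by letting t grow. *)
Lemma exp_cone_halfspaces (R : realType) (v : 'rV[R]_3) :
  exp_cone v <->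
  [/\ 0 <= ycoord v, 0 <= zcoord v &
      forall t, expR t * (xcoord v + (1 - t) * ycoord v) <= zcoord v].
Proof.
rewrite /exp_cone /=; move: (xcoord v) (ycoord v) (zcoord v) => x y z.
split=> [[[y_gt0 hz]|[x_le0 z_ge0 ->]]|[y_ge0 z_ge0 hz]].
- split; first exact: ltW.
    by apply: le_trans hz; rewrite mulr_ge0 ?expR_ge0 // ltW.
  move=> t; apply: le_trans hz.
  have -> : expR (x / y) = expR t * expR (x / y - t).
    by rewrite -expRD; congr expR; ring.
  have -> : x + (1 - t) * y = y * (1 + (x / y - t)) by field; lra.
  rewrite mulrCA ler_pM2l // ler_pM2l ?expR_gt0 //; exact: expR_ge1Dx.
- split => // t; rewrite mulr0 addr0.
  by apply: le_trans z_ge0; rewrite mulr_ge0_le0 ?expR_ge0.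
have [y0|y_neq0] := eqVneq y 0; [right | left].
  subst y; split => //; rewrite leNgt; apply/negP => x_gt0.
  (* An explicit slope suffices: [e^t >= 1 + t] at [t = z / x] gives [e^t x >= x + z > z]. *)
  have := hz (z / x); rewrite mulr0 addr0.
  have : (1 + z / x) * x <= expR (z / x) * x.
    by rewrite ler_pM2r // expR_ge1Dx.
  have -> : (1 + z / x) * x = x + z by field; lra.
  lra.
have y_gt0 : 0 < y by rewrite lt_def y_neq0.
split => //; have := hz (x / y).
suff -> : x + (1 - x / y) * y = y by rewrite mulrC.
by field.
Qed.

(** The half-space form avoids the quotient [x / y], which misbehaves at [y = 0], and presents the
    cone as an intersection of closed sets. *)
Lemma exp_cone_closed (R : realType) : closed (@exp_cone R).
Proof.
have closed_ge0 (f : 'rV[R]_3 -> R) : continuous f -> closed [set v | 0 <= f v].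
  move=> cf; apply: (@preimage_closed _ _ f [set x | 0 <= x]).
    by move=> x _; exact: cf.
  exact: closed_ge.
have -> : @exp_cone R = [set v | 0 <= ycoord v] `&` [set v | 0 <= zcoord v] `&`
    \bigcap_(t in [set: R]) [set v | 0 <= zcoord v -
      expR t * (xcoord v + (1 - t) * ycoord v)].
  apply/seteqP; split=> v.
    move/exp_cone_halfspaces => [y0 z0 hz]; split => // t _ /=.
    by rewrite subr_ge0.
  move=> [[y0 z0] hz]; apply/exp_cone_halfspaces; split => // t.
  by rewrite -subr_ge0; exact: hz.
have cx : continuous (@xcoord R) := @coord_continuous R 1 3 ord0 0.
have cy : continuous (@ycoord R) := @coord_continuous R 1 3 ord0 1.
have cz : continuous (@zcoord R) := @coord_continuous R 1 3 ord0 2.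
apply: closedI; first by apply: closedI; exact: closed_ge0.
apply: closed_bigI => t _; apply: closed_ge0 => v.
apply: (@continuousB R R _ (@zcoord R)); first exact: cz.
apply: continuousM; first exact: cst_continuous.
apply: (@continuousD R R _ (@xcoord R)); first exact: cx.
by apply: continuousM; [exact: cst_continuous | exact: cy].
Qed.

Lemma exp_cone_segment_closed (R : realType) : segment_closed (@exp_cone R).
Proof.
move=> u v t /exp_cone_halfspaces[yu zu hu] /exp_cone_halfspaces[yv zv hv].
move=> /andP[t0 t1]; apply/exp_cone_halfspaces.
rewrite /xcoord /ycoord /zcoord !mxE -/(xcoord u) -/(ycoord u) -/(zcoord u)
  -/(xcoord v) -/(ycoord v) -/(zcoord v).
have seg_ge0 a b : 0 <= a -> 0 <= b -> 0 <= a + t * (b - a).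
  move=> a0 b0; have -> : a + t * (b - a) = (1 - t) * a + t * b by ring.
  by rewrite addr_ge0 ?mulr_ge0 ?subr_ge0.
split; [exact: seg_ge0 | exact: seg_ge0 | move=> s].
have := hu s; have := hv s; rewrite -!(subr_ge0 (expR s * _)) => hvs hus.
have := seg_ge0 _ _ hus hvs; lra.
Qed.

Lemma exp_cone_neq0 (R : realType) : @exp_cone R !=set0.
Proof.
by exists 0; right; rewrite /= /xcoord /ycoord /zcoord !mxE.
Qed.

Lemma exp_ray_neq0 (R : realType) (beta : R) : exp_ray beta !=set0.
Proof. by eexists; exists 0 => //=. Qed.

Lemma perp_closed (R : realType) (n : nat) (z : 'rV[R]_n) : closed (perp z).
Proof.
apply: (@preimage_closed _ _ (dot z) [set x | x = 0]); last exact: closed_eq.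
move=> x _; apply: (@dot_continuous _ _ _ (fun=> z) id).
  exact: cst_continuous.
by move=> y; exact: cvg_id.
Qed.

Lemma perp_neq0 (R : realType) (n : nat) (z : 'rV[R]_n) : perp z !=set0.
Proof. by exists 0; rewrite /perp /= -(scale0r 0) dotZr mul0r. Qed.

Lemma perp_segment_closed (R : realType) (n : nat) (z : 'rV[R]_n) :
  segment_closed (perp z).
Proof.
move=> u v t; rewrite /perp /= => zu zv _.
by rewrite !dotE zu zv subrr mulr0 addr0.
Qed.

(** * Quantitative strict convexity of exp and the growth of [dot z] on the cone *)

(** Squaring [1 + s / 2 <= e^(s/2)] bounds the gap below by [s^2 / 4], but only while
    [1 + s / 2 >= 0]. For [s < -2] the gap exceeds [|s| - 1], and the factor [1 + |s|] compensates
    for this merely linear growth. *)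
Lemma sqr_le_expR_gap (R : realType) (s : R) :
  s ^+ 2 <= 4 * (1 + `|s|) * (expR s - 1 - s).
Proof.
have g0 : 0 <= expR s - 1 - s by have := expR_ge1Dx s; lra.
have [s_ge|s_lt] := leP (- 2) s.
  have : (1 + s / 2) ^+ 2 <= expR s.
    have -> : expR s = expR (s / 2) ^+ 2.
      by rewrite -expRM_natl; congr expR; field.
    rewrite ler_pXn2r ?nnegrE ?expR_ge0 //; last lra.
    exact: expR_ge1Dx.
  have := mulr_ge0 (normr_ge0 s) g0; lra.
have := expR_gt0 s; rewrite ltr0_norm; last lra.
move: (expR s) g0 => e g0 e_gt0; nra.
Qed.

Lemma dot_vec3 (R : realType) (v : 'rV[R]_3) (x y z : R) :
  dot v (vec3 x y z) = xcoord v * x + ycoord v * y + zcoord v * z.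
Proof.
rewrite /dot /vec3 !big_ord_recl big_ord0 !mxE /= addr0 addrA.
by congr (_ * _ + v _ _ * _ + v _ _ * _); apply/val_inj.
Qed.

Lemma vec3_coords (R : realType) (v : 'rV[R]_3) :
  v = vec3 (xcoord v) (ycoord v) (zcoord v).
Proof.
by apply/rowP => -[[|[|[|//]]] lti]; rewrite mxE /=; congr (v _ _); apply/val_inj.
Qed.

Lemma vec3E (R : realType) (x y w : R) :
  (xcoord (vec3 x y w) = x) * (ycoord (vec3 x y w) = y) *
  (zcoord (vec3 x y w) = w).
Proof. by rewrite /xcoord /ycoord /zcoord !mxE. Qed.

(** Along the curve [(1 - beta + s, 1, e^(1 - beta + s))] in the cone, [dot z] is nonnegative and
    vanishes at [s = 0]. This minimum forces the slope [g + c] to be zero, which fixes the direction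
    of [z]. *)
Lemma exp_cone_exposing_normal (R : realType) (beta : R) (z : 'rV[R]_3) :
  dual_cone (@exp_cone R) z -> xcoord z < 0 ->
  dot z (vec3 (1 - beta) 1 (expR (1 - beta))) = 0 ->
  ycoord z = beta * xcoord z /\ zcoord z * expR (1 - beta) = - xcoord z.
Proof.
move=> z_dual zx_lt0; rewrite dot_vec3 mulr1.
set E := expR (1 - beta); set c := xcoord z; set g := zcoord z * E => z_perp.
have zz_ge0 : 0 <= zcoord z.
  have := z_dual (vec3 0 0 1); rewrite dot_vec3 !mulr0 !add0r mulr1; apply.
  by right; rewrite /= !vec3E.
have g_ge0 : 0 <= g by rewrite mulr_ge0 // expR_ge0.
have tangent s : 0 <= g * (expR s - 1) + c * s.
  have := z_dual (vec3 (1 - beta + s) 1 (E * expR s)).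
  rewrite dot_vec3 -/c mulr1 mulrA -/g => h.
  suff /h : exp_cone (vec3 (1 - beta + s) 1 (E * expR s)) by lra.
  left; rewrite /= !vec3E !divr1 mul1r expRD lexx.
  by split.
(* In place of a derivative, [e^s <= 1 / (1 - s)] replaces the exponential by a quadratic polynomial
   in [s]. *)
have gap s : s < 1 -> 0 <= s * (g + c * (1 - s)).
  move=> s_lt1.
  have e_le : (expR s - 1) * (1 - s) <= s.
    have := ler_wpM2l (expR_ge0 s) (expR_ge1Dx (- s)).
    rewrite -expRD subrr expR0; lra.
  have := mulr_ge0 (tangent s) (_ : 0 <= 1 - s); rewrite subr_ge0.
  move=> /(_ (ltW s_lt1)); have := ler_wpM2l g_ge0 e_le; lra.
rewrite -/c in zx_lt0; suff gc : g = - c by split => //; lra.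
(* The vertex of the quadratic; its value there is a negative multiple of [(c + g)^2], so
   nonnegativity leaves only [g = - c]. *)
have s_lt1 : (- c - g) / (- 2 * c) < 1.
  by rewrite ltr_pdivrMr; lra.
have := gap _ s_lt1.
have -> : (- c - g) / (- 2 * c) * (g + c * (1 - (- c - g) / (- 2 * c))) =
    - ((c + g) ^+ 2 / (- 4 * c)).
  by field; lra.
rewrite oppr_ge0 pmulr_lle0 ?invr_gt0; last lra.
move=> h; have /eqP : (c + g) ^+ 2 = 0.
  by apply/eqP; rewrite eq_le h sqr_ge0.
by rewrite sqrf_eq0 => /eqP; lra.
Qed.

(* With p := y (1 - beta, 1, E) on the ray, where E := expR (1 - beta), one has
   v - p = (a, 0, E b), while dot z v = - xcoord z * (b - a). *)
Lemma exp_cone_gap (R : realType) (beta : R) (v : 'rV[R]_3) : exp_cone v ->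
  let a := xcoord v - (1 - beta) * ycoord v in
  let b := zcoord v / expR (1 - beta) - ycoord v in
  a ^+ 2 <= 4 * (ycoord v + `|a|) * (b - a).
Proof.
rewrite /exp_cone /=; move: (xcoord v) (ycoord v) (zcoord v) => x y z.
set E := expR (1 - beta); have E_gt0 : 0 < E by exact: expR_gt0.
case=> [[y_gt0 hz]|[x_le0 z_ge0 ->]]; last first.
  rewrite mulr0 !subr0 add0r ler0_norm //.
  have b_ge0 : 0 <= z / E by rewrite divr_ge0 // ltW.
  move: (z / E) b_ge0 => b b_ge0; nra.
(* For [y > 0] everything is homogeneous in [y]: [b - a] dominates [y] times the scalar gap at
   [s = a / y], so the scalar estimate is scaled by [y^2]. *)
set a := x - _; pose s := a / y.
have aE : a = y * s by rewrite /s; field; lra.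
have hb : y * (expR s - 1 - s) <= z / E - y - a.
  have : y * expR s <= z / E.
    rewrite ler_pdivlMr // -mulrA -expRD.
    suff -> : s + (1 - beta) = x / y by [].
    by rewrite /s /a; field; lra.
  rewrite [in X in _ -> X]aE; lra.
have := sqr_le_expR_gap s.
rewrite -(ler_pM2l (_ : 0 < y ^+ 2)) ?exprn_gt0 // => hs.
have -> : a ^+ 2 = y ^+ 2 * s ^+ 2 by rewrite aE; ring.
apply: (le_trans hs).
have -> : y + `|a| = y * (1 + `|s|) by rewrite aE normrM gtr0_norm //; ring.
have -> : y ^+ 2 * (4 * (1 + `|s|) * (expR s - 1 - s)) =
  4 * (y * (1 + `|s|)) * (y * (expR s - 1 - s)) by ring.
apply: ler_wpM2l => //.
by rewrite mulr_ge0 // mulr_ge0 ?addr_ge0 // ltW.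
Qed.

(** The ray point with the same y-coordinate as [v] serves as [p]. In the ball the factor [y + |a|]
    is bounded, so [a^2] and [b^2] are both controlled by [b - a], a positive multiple of
    [dot z v]. *)
Lemma exp_cone_hoelder (R : realType) (beta eta : R) (z : 'rV[R]_3) :
  dual_cone (@exp_cone R) z -> xcoord z < 0 ->
  dot z (vec3 (1 - beta) 1 (expR (1 - beta))) = 0 -> 0 <= eta ->
  exists2 C : R, 0 <= C & forall v, exp_cone v -> enorm v <= eta ->
    exists2 p, exp_ray beta p & enorm (v - p) ^+ 2 <= C * dot z v.
Proof.
move=> z_dual zx_lt0 z_perp eta_ge0.
have [zy zz] := exp_cone_exposing_normal z_dual zx_lt0 z_perp.
set E := expR (1 - beta) in zz *.
have E_gt0 : 0 < E by exact: expR_gt0.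
(* Chosen to bound both [y + |a|] and [|a| + |b|] when all coordinates are at most [eta] in absolute
   value. *)
pose M := eta * (2 + `|1 - beta| + E^-1).
have M_ge0 : 0 <= M by rewrite mulr_ge0 // !addr_ge0 // invr_ge0 ltW.
have k_ge0 : 0 <= 4 + 5 * E ^+ 2 by have := sqr_ge0 E; lra.
exists ((4 + 5 * E ^+ 2) * M / - xcoord z).
  by apply: divr_ge0; [exact: mulr_ge0 | rewrite oppr_ge0 ltW].
move=> v Kv v_le.
have y_ge0 : 0 <= ycoord v by case/exp_cone_halfspaces: (Kv).
exists (vec3 (- beta * ycoord v + ycoord v) (ycoord v) (E * ycoord v)).
  by exists (ycoord v).
have := z_dual v Kv; have := exp_cone_gap beta Kv; cbv zeta; rewrite -/E.
have coord_le i : `|v ord0 i| <= eta.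
  exact: le_trans (normr_coord_le_enorm v i) v_le.
have : `|xcoord v| <= eta := coord_le _.
have : `|ycoord v| <= eta := coord_le _.
have : `|zcoord v| <= eta := coord_le _.
have -> : dot z v =
    xcoord z * xcoord v + ycoord z * ycoord v + zcoord z * zcoord v.
  by rewrite {1}(vec3_coords v) dot_vec3.
have -> : v - vec3 (- beta * ycoord v + ycoord v) (ycoord v) (E * ycoord v) =
    vec3 (xcoord v - (- beta * ycoord v + ycoord v)) 0
      (zcoord v - E * ycoord v).
  apply/rowP => i; rewrite {1}(vec3_coords v) !mxE.
  by case: i => -[|[|[|//]]] lti /=; rewrite ?subrr.
rewrite enorm_sqr dot_vec3 !vec3E.
move: (xcoord v) (ycoord v) (zcoord v) y_ge0 => x y w y_ge0 w_le y_le x_le.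
set a := x - _; set b := w / E - y => hab zv_ge0.
have zzE : zcoord z = - xcoord z / E by rewrite -zz; field; lra.
have -> : (4 + 5 * E ^+ 2) * M / - xcoord z *
    (xcoord z * x + ycoord z * y + zcoord z * w) =
    (4 + 5 * E ^+ 2) * M * (b - a).
  by rewrite zy zzE /a /b; field; rewrite gt_eqF //= lt_eqF.
have -> : x - (- beta * y + y) = a by rewrite /a; ring.
have -> : w - E * y = E * b by rewrite /b; field; lra.
have a_le : `|a| <= eta * (1 + `|1 - beta|).
  apply: le_trans (ler_normB _ _) _; rewrite normrM.
  have := ler_pM (normr_ge0 (1 - beta)) (normr_ge0 y) (lexx _) y_le; lra.
have b_le : `|b| <= eta * (1 + E^-1).
  apply: le_trans (ler_normB _ _) _.
  rewrite normrM (gtr0_norm (_ : 0 < E^-1)) ?invr_gt0 //.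
  have := ler_wpM2r (_ : 0 <= E^-1) w_le; rewrite invr_ge0 ltW //.
  move=> /(_ isT); lra.
have Ei : 0 <= eta * E^-1 by rewrite mulr_ge0 // invr_ge0 ltW.
have Bi : 0 <= eta * `|1 - beta| by rewrite mulr_ge0.
have yM : y + `|a| <= M.
  by move: y_le; rewrite ger0_norm // /M; lra.
have abM : `|a| + `|b| <= M by rewrite /M; lra.
have D_ge0 : 0 <= b - a.
  rewrite -(pmulr_rge0 _ (_ : 0 < - xcoord z)) ?oppr_gt0 //.
  move: zv_ge0; rewrite zy zzE /a /b.
  by congr (0 <= _); field; rewrite gt_eqF.
have a_sqr : a ^+ 2 <= 4 * M * (b - a).
  by apply: (le_trans hab); rewrite ler_wpM2r // ler_wpM2l.
(* From [b^2 = a^2 + (a + b) (b - a)], whence the constant 5 = 4 + 1. *)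
have b_sqr : b ^+ 2 <= 5 * M * (b - a).
  have : (a + b) * (b - a) <= M * (b - a).
    by rewrite ler_wpM2r // (le_trans (ler_norm _)) // (le_trans (ler_normD _ _)).
  by move: a_sqr; lra.
have := ler_wpM2l (sqr_ge0 E) b_sqr; lra.
Qed.

(** * Positivity of the infimum *)

Lemma gamma_gt0 (R : realType) (beta eta : R) (z : 'rV[R]_3) :
  dual_cone (@exp_cone R) z -> xcoord z < 0 ->
  exp_ray beta = perp z `&` @exp_cone R -> 0 <= eta ->
  (0 < gamma z beta eta)%E.
Proof.
move=> z_dual zx_lt0 rayE eta_ge0.
have ray_perp p : exp_ray beta p -> dot z p = 0 by rewrite rayE => -[].
have z_perp : dot z (vec3 (1 - beta) 1 (expR (1 - beta))) = 0.
  apply: ray_perp; exists 1; first exact: ler01.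
  by rewrite !mulr1 addrC.
have [C C_ge0 holder] := exp_cone_hoelder z_dual zx_lt0 z_perp eta_ge0.
(* Every admissible quotient is at least [1 / sqrt k]; the added 1 keeps [k] positive even if
   [C = 0]. *)
pose k := 4 * C * enorm z + 1.
have k_gt0 : 0 < k.
  by have := mulr_ge0 C_ge0 (enorm_ge0 z); rewrite /k; lra.
apply: (@lt_le_trans _ _ ((Num.sqrt k)^-1)%:E).
  by rewrite lte_fin invr_gt0 sqrtr_gt0.
apply: le_ereal_inf_tmp => _ [v] [w] [u] [[[[clKv _] v_le] _] wE uE wu ->].
have Kv : exp_cone v by apply: (exp_cone_closed clKv).
have [p ray_p vp] := holder v Kv v_le.
have [zw w_min] : nearest (perp z) v w.
  by rewrite wE; apply: proj_nearest; [exact: perp_closed | exact: perp_neq0].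
have [_ u_min] : nearest (exp_ray beta) w u.
  rewrite uE; apply: proj_nearest; last exact: exp_ray_neq0.
  by rewrite rayE; apply: closedI; [exact: perp_closed | exact: exp_cone_closed].
have wu_gt0 : 0 < enorm (w - u).
  rewrite lt_def enorm_ge0 andbT; apply/eqP => /enorm_eq0/subr0_eq.
  exact: wu.
have wv_ge0 := enorm_ge0 (w - v).
rewrite lee_fin ler_pdivlMr // mulrC ler_pdivrMr ?sqrtr_gt0 //.
have -> : enorm (w - u) = Num.sqrt (enorm (w - u) ^+ 2).
  by rewrite sqrtr_sqr ger0_norm ?enorm_ge0.
rewrite -sqrtrM //.
rewrite ler_sqrt; last by rewrite mulr_ge0 // ltW.
(* Since [p] lies in both the ray and the hyperplane, minimality of [u] and of [w] applies to it,
   each distance contributing one [|v - p|]. *)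
have wu_le : enorm (w - u) <= 2 * enorm (v - p).
  apply: (le_trans (u_min _ ray_p)).
  have -> : w - p = - (v - w) + (v - p) by apply/rowP => i; rewrite !mxE; ring.
  apply: (le_trans (enormD _ _)); rewrite enormN.
  have := w_min p (ray_perp p ray_p); lra.
have zv_le : dot z v <= enorm z * enorm (w - v).
  have -> : dot z v = dot z (v - w) by rewrite dotDr dotNr zw subr0.
  by rewrite -(opprB v w) enormN dot_le_enorm.
have := ler_wpM2l C_ge0 zv_le.
have : enorm (w - u) ^+ 2 <= (2 * enorm (v - p)) ^+ 2.
  by rewrite ler_pXn2r ?nnegrE ?mulr_ge0 ?enorm_ge0.
rewrite /k; lra.
Qed.

(** * The error bound *)

Theorem theorem4p6 (R : realType) (beta : R) (z : 'rV[R]_3)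
  (z_dual : dual_cone (@exp_cone R) z)
  (zx_lt0 : xcoord z < 0)
  (ray_exposed : exp_ray beta = perp z `&` @exp_cone R)
  (ray_face : is_face (@exp_cone R) (exp_ray beta))
  (ray_dim : cone_dim (exp_ray beta) 1)
  (eta : R) (eta_gt0 : 0 < eta) :
  (0 < gamma z beta eta)%E /\
  forall q : 'rV[R]_3, (perp z `&` eball eta) q ->
    ((dist q (exp_ray beta))%:E <=
       maxe (2 * Num.sqrt eta)%:E (2%:E * (gamma z beta eta)^-1) *
       (Num.sqrt (dist q (@exp_cone R)))%:E)%E.
Proof.
have gam_gt0 := gamma_gt0 z_dual zx_lt0 ray_exposed (ltW eta_gt0).
split=> // q [zq q_le].
have [v qv] := nearest_exists q (@exp_cone_closed R) (@exp_cone_neq0 R).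
have [Kv _] := qv.
rewrite (dist_nearest qv); set d := enorm (q - v).
have d_ge0 : 0 <= d by exact: enorm_ge0.
(* Comparison with the origin bounds both [d] and [|v|] by [|q| <= eta]; the latter makes [v]
   eligible for [gamma]. *)
have K0 : exp_cone (0 : 'rV[R]_3).
  by right; rewrite /= /xcoord /ycoord /zcoord !mxE.
have d_le : d <= eta by apply: le_trans (qv.2 _ K0) _; rewrite subr0.
have v_le : enorm v <= eta.
  have := nearest_le (@exp_cone_segment_closed R) qv K0.
  by rewrite !subr0 => /le_trans; apply.
have d_split : d <= Num.sqrt eta * Num.sqrt d.
  rewrite -{1}(sqr_sqrtr d_ge0) expr2 ler_wpM2r ?sqrtr_ge0 //.
  by rewrite ler_sqrt // ltW.
(* A bound linear in [d] is absorbed by the first entry of the maximum, through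
   [d <= sqrt eta * sqrt d]. *)
have near_case : dist q (exp_ray beta) <= 2 * d ->
    ((dist q (exp_ray beta))%:E <=
       maxe (2 * Num.sqrt eta)%:E (2%:E * (gamma z beta eta)^-1) *
       (Num.sqrt d)%:E)%E.
  move=> qd; apply: (@le_trans _ _ ((2 * Num.sqrt eta)%:E * (Num.sqrt d)%:E)%E).
    by rewrite -EFinM lee_fin -mulrA; lra.
  by rewrite lee_wpmul2r ?lee_fin ?sqrtr_ge0 // le_max lexx.
have [ray_v|nray_v] := pselect (exp_ray beta v).
  by apply: near_case; have := dist_le q ray_v; rewrite -/d; lra.
(* A point [q] of the cone would be its own projection [v] and lie on the exposed ray. Hence [q] is
   outside and [v] is on the boundary. *)
have nKq : ~ exp_cone q.
  move=> Kq; apply: nray_v.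
  have := qv.2 q Kq; rewrite subrr enorm0 => d_le0.
  have /enorm_eq0/subr0_eq <- : enorm (q - v) = 0.
    by apply/eqP; rewrite eq_le d_le0 enorm_ge0.
  by rewrite ray_exposed.
pose w := Defs.proj (perp z) v; pose u := Defs.proj (exp_ray beta) w.
have vw : nearest (perp z) v w.
  by apply: proj_nearest; [exact: perp_closed | exact: perp_neq0].
have [ray_u _] : nearest (exp_ray beta) w u.
  apply: proj_nearest; last exact: exp_ray_neq0.
  rewrite ray_exposed.
  by apply: closedI; [exact: perp_closed | exact: exp_cone_closed].
have vq : enorm (v - q) = d by rewrite -(opprB q v) enormN.
have wq_le : enorm (q - w) <= d.
  rewrite -vq -(opprB w) enormN.
  exact: nearest_le (@perp_segment_closed R 3 z) vw zq.
have wv_le : enorm (w - v) <= d.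
  by rewrite -vq -(opprB v w) enormN; exact: vw.2.
have qu_le : dist q (exp_ray beta) <= d + enorm (w - u).
  apply: (le_trans (dist_le q ray_u)).
  have -> : q - u = (q - w) + (w - u) by rewrite addrA subrK.
  by apply: (le_trans (enormD _ _)); rewrite lerD2r.
(* The case [w = u] is excluded from [gamma], but then [w] itself is on the ray within [d] of
   [q]. *)
have [wu|/eqP wu] := eqVneq w u.
  apply: near_case; move: qu_le; rewrite -wu subrr enorm0; lra.
pose r := Num.sqrt (enorm (w - v)) / enorm (w - u).
have gam_le : (gamma z beta eta <= r%:E)%E.
  apply: ereal_inf_lbound; exists v, w, u; split => //; split => //.
  by split => //; exact: nearest_boundary nKq.
(* The finite bound [r] rules out [+oo] and positivity rules out [-oo]. *)
case gamE : (gamma z beta eta) gam_gt0 gam_le => [g| |] //.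
rewrite lte_fin lee_fin => g_gt0 g_le.
have wu_gt0 : 0 < enorm (w - u).
  by rewrite lt_def enorm_ge0 andbT; apply/eqP => /enorm_eq0/subr0_eq.
have wu_le : enorm (w - u) <= g^-1 * Num.sqrt d.
  rewrite mulrC ler_pdivlMr //.
  apply: (@le_trans _ _ (Num.sqrt (enorm (w - v)))).
    by move: g_le; rewrite /r ler_pdivlMr // mulrC.
  by rewrite ler_sqrt.
rewrite inver gt_eqF // -EFinM -EFin_max -EFinM lee_fin.
(* Both summands [d] and [|w - u|] are at most [(m / 2) * sqrt d], which explains the factors 2. *)
set m := Num.max _ _.
have m1 : 2 * Num.sqrt eta <= m by rewrite le_max lexx.
have m2 : 2 * g^-1 <= m by rewrite le_max lexx orbT.
have := ler_wpM2r (sqrtr_ge0 d) m1; have := ler_wpM2r (sqrtr_ge0 d) m2.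
lra.
Qed.
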